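(* Let $(U,\mathcal U)$ be a measurable space and let $\mu,\nu$ be two finite monotone measures on $(U,\mathcal U)$. Then the following two assertions are equivalent: (i) There is a nonnegative measurable function $f\colon U\to[0,\infty]$ such that $$\mu(A)=\int_A f\,d\nu\qquad\text{for all }A\in\mathcal U,$$ where the integral is the Choquet integral. (ii) The ordered pair $(\mu,\nu)$ has the decomposition property with respect to some family $\{A_\alpha\}_{\alpha\in\mathbb Q^+}$ of measurable sets which moreover satisfies $\lim_{\alpha\to\infty}\max\{\mu(A_\alpha),\nu(A_\alpha)\}=0$.
   Context: A measurable space $(U,\mathcal U)$ is a nonempty set $U$ with a $\sigma$-algebra $\mathcal U$ of subsets. A function $f\colon U\to[0,\infty]$ is measurable if $\{f\ge\alpha\}=\{t\in U: f(t)\ge\alpha\}\in\mathcal U$ for every $\alpha\in[0,\infty]$. A monotone measure on $(U,\mathcal U)$ is a set function $\mu\colon\mathcal U\to[0,\infty]$ with $\mu(\emptyset)=0$ and $\mu(A)\le\mu(B)$ whenever $A\subset B$, $A,B\in\mathcal U$ (no additivity or continuity is assumed). It is finite if $\mu(U)<\infty$. The Choquet integral of a nonnegative measurable $f$ with respect to a monotone measure $\nu$ on $A\in\mathcal U$ is $\int_A f\,d\nu=\int_0^\infty \nu(\{f\ge\alpha\}\cap A)\,d\alpha$ (improper Riemann integral, with value in $[0,\infty]$). $\mathbb Q^+$ denotes the set of all nonnegative rational numbers (including $0$). Decomposition property: for monotone measures $\mu,\nu$ on $(U,\mathcal U)$, the ordered pair $(\mu,\nu)$ has the decomposition property with respect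 to $\{A_\alpha\}_{\alpha\in\mathbb Q^+}$ if $\{A_\alpha\}_{\alpha\in\mathbb Q^+}$ is a decreasing family of measurable sets (i.e. $A_\beta\subset A_\alpha$ for $\alpha<\beta$) with $A_0=U$ such that $$\alpha\big(\nu(A\cap A_\alpha)-\nu(A\cap A_\beta)\big)\le \mu(A\cap A_\alpha)-\mu(A\cap A_\beta)\le \beta\big(\nu(A\cap A_\alpha)-\nu(A\cap A_\beta)\big)$$ for every $A\in\mathcal U$ with $\mu(A)<\infty$ and $\nu(A)<\infty$ and all $\alpha,\beta\in\mathbb Q^+$ with $\alpha<\beta$. Limits as $\alpha\to\infty$ are taken along $\alpha\in\mathbb Q^+$. *)

(* Defs.v *)
From HB Require Import structures.
From mathcomp Require Import all_boot all_order all_algebra.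
From mathcomp Require Import all_classical all_reals all_analysis.

Set Implicit Arguments.
Unset Strict Implicit.
Unset Printing Implicit Defensive.

Import Order.TTheory GRing.Theory Num.Theory.
Import numFieldNormedType.Exports.

Local Open Scope classical_set_scope.
Local Open Scope ring_scope.
Local Open Scope ereal_scope.

(** Riemann integral, in Darboux form, of functions valued in the extended
    reals: the lower and upper integrals both equal the given value. *)
Section riemann_integral.
Variable R : realType.
Implicit Types (h : R -> \bar R) (a b : R) (s : seq R) (v : \bar R).

(* [itv_partition a b s] says that a = x_0 < x_1 < ... < x_n = b, where
   [:: x_1; ...; x_n] is [s]; thus [nth b (a :: s) i] is x_i. *)
Definition lower_sum h a b s : \bar R :=
  let x := nth b (a :: s) in
  \sum_(0 <= i < size s)
    (x i.+1 - x i)%:E * ereal_inf (h @` `[x i, x i.+1]%classic).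

Definition upper_sum h a b s : \bar R :=
  let x := nth b (a :: s) in
  \sum_(0 <= i < size s)
    (x i.+1 - x i)%:E * ereal_sup (h @` `[x i, x i.+1]%classic).

Definition lower_integral h a b : \bar R :=
  ereal_sup [set lower_sum h a b s | s in itv_partition a b].

Definition upper_integral h a b : \bar R :=
  ereal_inf [set upper_sum h a b s | s in itv_partition a b].

Definition is_riemann_integral h a b v :=
  lower_integral h a b = v /\ upper_integral h a b = v.

(* The integral over ]0, +oo[ is taken as improper at both ends: for
   h bounded near 0 this is the limit of the integrals over [0, b], and it
   also covers the case where h is unbounded, or infinite, at 0. *)
Definition is_improper_riemann_integral h v :=
  exists2 F : R * R -> \bar R,
    \forall p \near (0%R^'+, +oo%R), is_riemann_integral h p.1 p.2 (F p) &
    F p @[p --> (0%R^'+, +oo%R)] --> v.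

Lemma is_improper_riemann_integral_unique h v w :
  is_improper_riemann_integral h v -> is_improper_riemann_integral h w -> v = w.
Proof.
move=> [F hF Fv] [G hG Gw]; apply: (cvg_unique _ Fv) => //.
apply: cvg_trans Gw; apply: near_eq_cvg.
by apply: filterS2 hF hG => p [<- _] [<- _].
Qed.

End riemann_integral.

Section monotone_measures.
Context d (T : measurableType d) (R : realType).
Implicit Types (mu nu : set T -> \bar R) (A : set T) (f : T -> \bar R).

(* Set functions are total on [set T]; only their values on measurable sets
   are constrained or used. *)
Definition monotone_measure mu :=
  [/\ mu set0 = 0,
      forall A, measurable A -> 0 <= mu A &
      forall A B, measurable A -> measurable B -> A `<=` B -> mu A <= mu B].

Definition finite_monotone_measure mu :=
  monotone_measure mu /\ mu setT < +oo.

(* [is_choquet_integral nu A f v] : the Choquet integral of f over A with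
   respect to nu is v. *)
Definition is_choquet_integral nu A f v :=
  is_improper_riemann_integral
    (fun alpha : R => nu ([set t | alpha%:E <= f t] `&` A)) v.

(* The index set of nonnegative rationals is rendered by guarding every index
   of a [rat]-indexed family with [0 <= _]. *)
Definition decomposition_property mu nu (F : rat -> set T) :=
  [/\ forall alpha, (0 <= alpha)%R -> measurable (F alpha),
      forall alpha beta, (0 <= alpha)%R -> (alpha < beta)%R ->
        F beta `<=` F alpha,
      F 0%R = setT &
      forall A, measurable A -> mu A < +oo -> nu A < +oo ->
      forall alpha beta, (0 <= alpha)%R -> (alpha < beta)%R ->
        (ratr alpha)%:E * (nu (A `&` F alpha) - nu (A `&` F beta))
          <= mu (A `&` F alpha) - mu (A `&` F beta) /\
        mu (A `&` F alpha) - mu (A `&` F beta)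
          <= (ratr beta)%:E * (nu (A `&` F alpha) - nu (A `&` F beta))].

End monotone_measures.

(* Main.v *)
Require Import Defs.
From mathcomp Require Import all_boot all_order all_algebra.
From mathcomp Require Import all_classical all_reals all_analysis.
From mathcomp Require Import measurable_realfun ring lra.
Import Order.TTheory GRing.Theory Num.Theory.
Import numFieldNormedType.Exports.
Local Open Scope classical_set_scope.
Local Open Scope ring_scope.

Set Implicit Arguments.
Unset Strict Implicit.
Unset Printing Implicit Defensive.

(** For A and f measurable, put k(t) = nu ({f >= t} `&` A).  This is
    a nonincreasing nonnegative real function of t, so it has a primitive K
    with K 0 = 0 ([primitive_exists]); its increments are squeezed between the
    lower and the upper rectangle,
      (t - s) k(t) <= K t - K s <= (t - s) k(s)  for 0 <= s <= t,
    and the Choquet integral of f over A is the limit of K at infinity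
    ([choquet_integralP]).  Conversely such a squeeze on the rationals
    determines increments ([pinched_unique]).

    The decomposition property is the same squeeze in disguise.  With
    m(q) = mu (A `&` F q) and g(q) = nu (A `&` F q), its two inequalities are
    equivalent to
      (b - a) g(b) <= J(b) - J(a) <= (b - a) g(a),  J(q) = q g(q) - m(q),
    for rationals 0 <= a < b; the quantity - J(q) = m(q) - q g(q) plays the
    part of the tail of the Choquet integral beyond q.

    From (i) to (ii), take F q = {f >= q}.  Truncating A to A `&` F q freezes k
    on [0, q] and does not change it beyond q, whence
      m(q) = mu A - K q + q k(q)   ([choquet_superlevel]),
    that is, J and K differ by a constant, and the squeeze for K is the
    decomposition property.  The same formula gives the limit condition, since
    q k(q) / 2 <= K q - K (q / 2) and K converges to the finite value mu U.

    From (ii) to (i), let f(x) be the supremum of the q with x in F q.  The set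
    {f >= t} lies between F b and F a whenever a < t <= b, so K is squeezed by g
    on the rationals exactly as J is, and K q = mu A - (m(q) - q g(q)) for
    rational q >= 0.  Finally 0 <= m(q) - q g(q) <= mu (F q), which tends to 0,
    so K tends to mu A ([choquet_of_decomposition]). *)

(** * Functions on the rationals with squeezed increments *)

Section pinched.
Variable R : realType.
Implicit Types (g phi psi : rat -> R) (r s : rat).

Definition pinched g s phi := forall alpha beta, s <= alpha -> alpha < beta ->
  ratr (beta - alpha) * g beta <= phi beta - phi alpha
    <= ratr (beta - alpha) * g alpha.

(** On one step from x to x + h the two increments differ by at most
    h * (g x - g (x + h)).  These errors telescope along an arithmetic
    progression, and their total vanishes as the progression is refined. *)
Lemma pinched_step g s phi psi (h : rat) n :
  pinched g s phi -> pinched g s psi -> 0 < h ->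
  (phi (s + h * n%:R) - phi s) - (psi (s + h * n%:R) - psi s)
    <= ratr h * (g s - g (s + h * n%:R)).
Proof.
move=> Hphi Hpsi h0; elim: n => [|n IHn].
  by rewrite mulr0 addr0 !subrr mulr0.
have sn : s <= s + h * n%:R by rewrite lerDl mulr_ge0// ltW.
have e : s + h * n.+1%:R = s + h * n%:R + h by rewrite -natr1; ring.
have lt : s + h * n%:R < s + h * n.+1%:R by rewrite e ltrDl.
have dh : s + h * n.+1%:R - (s + h * n%:R) = h by rewrite e; ring.
move: (Hphi _ _ sn lt) (Hpsi _ _ sn lt); rewrite dh => /andP[_ ?] /andP[? _].
lra.
Qed.

Lemma pinched_le g s phi psi r : pinched g s phi -> pinched g s psi ->
  s <= r -> phi r - phi s <= psi r - psi s.
Proof.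
move=> Hphi Hpsi; rewrite le_eqVlt => /predU1P[->|sr]; first by rewrite !subrr.
apply/ler_addgt0Pr => e e0.
pose c := ratr (r - s) * (g s - g r).
pose n := (Num.truncn (c / e)).+1.
have cn : c / n%:R < e.
  by rewrite ltr_pdivrMr// mulrC -ltr_pdivrMr// truncnS_gt.
have hn : s + (r - s) / n%:R * n%:R = r by rewrite divfK ?pnatr_eq0//; ring.
have h0 : 0 < (r - s) / n%:R by rewrite divr_gt0 ?ltr0n// subr_gt0.
have := pinched_step n Hphi Hpsi h0; rewrite hn fmorph_div/= ratr_nat.
have -> : ratr (r - s) / n%:R * (g s - g r) = c / n%:R by rewrite /c mulrAC.
lra.
Qed.

Lemma pinched_unique g s phi psi r : pinched g s phi -> pinched g s psi ->
  s <= r -> phi r - phi s = psi r - psi s.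
Proof.
by move=> Hphi Hpsi sr; apply/eqP; rewrite eq_le !(@pinched_le g).
Qed.

End pinched.

(** * Primitives of nonincreasing functions *)

Section primitive.
Variable R : realType.
Implicit Types (k K : R -> R) (a b s t : R).

(** The upper bound allows any c that dominates k on the half-open interval
    ]s, t], and not only k s: k may jump down just to the right of s. *)
Definition primitive k K := K 0 = 0 /\ forall s t, 0 <= s -> s <= t ->
  (t - s) * k t <= K t - K s /\
  forall c, (forall x, s < x -> x <= t -> k x <= c) -> K t - K s <= (t - s) * c.

Lemma primitive_exists k : nonincreasing_fun k -> exists K, primitive k K.
Proof.
move=> kni.
have mk D : measurable D -> measurable_fun D k.
  by move=> mD; exact: nonincreasing_measurable.
have intk s t : (@lebesgue_measure R).-integrable `]s, t]%classic (EFin \o k).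
  apply: measurable_bounded_integrable => //; last 2 first.
  - exact: mk.
  - exists (`|k s| + `|k t|); split; first exact: num_real.
    move=> M hM x /=; rewrite in_itv/= => /andP[sx xt]; apply/ltW/(le_lt_trans _ hM).
    have := kni _ _ (ltW sx); have := kni _ _ xt.
    have := ler_norm (k s); have := ler_norm (- k t); rewrite normrN => ? ? ? ?.
    rewrite ler_norml; have := normr_ge0 (k s); have := normr_ge0 (k t).
    by move=> ? ?; apply/andP; split; lra.
  by rewrite /= lebesgue_measure_itv/=; case: ifP => // _; rewrite -EFinB ltry.
have intc c s t : (@lebesgue_measure R).-integrable `]s, t]%classic (EFin \o cst c).
  apply: measurable_bounded_integrable => //.
  - by rewrite /= lebesgue_measure_itv/=; case: ifP => // _; rewrite -EFinB ltry.
  - exists `|c|; split; first exact: num_real.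
    by move=> M hM x _; exact: ltW.
have len s t c : s <= t -> \int[lebesgue_measure]_(x in `]s, t]) c = (t - s) * c.
  move=> st; rewrite Rintegral_cst// mulrC /= lebesgue_measure_itv/= lte_fin.
  move: st; rewrite le_eqVlt => /predU1P[->|->//].
  by rewrite ltxx subrr.
exists (fun t => \int[lebesgue_measure]_(x in `]0, t]) k x).
split; first by rewrite set_itv_ge ?Rintegral_set0// bnd_simp ltxx.
move=> s t s0 st; rewrite Rintegral_itvB//.
split => [|c kc]; rewrite -len//; apply: le_Rintegral => //.
- exact: intc.
- by move=> x /=; rewrite in_itv/= => /andP[_]; exact: kni.
- exact: intc.
- by move=> x /=; rewrite in_itv/= => /andP[]; exact: kc.
Qed.

Lemma primitive_le k K s t : nonincreasing_fun k -> primitive k K ->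
  0 <= s -> s <= t -> K t - K s <= (t - s) * k s.
Proof.
move=> kni [_ KP] s0 st; have [_] := KP s t s0 st; apply => x sx _.
exact/kni/ltW.
Qed.

Lemma primitive_nondecreasing k K s t : (forall x, 0 <= k x) -> primitive k K ->
  0 <= s -> s <= t -> K s <= K t.
Proof.
move=> k0 [_ KP] s0 st; rewrite -subr_ge0; have [+ _] := KP _ _ s0 st.
by apply: le_trans; rewrite mulr_ge0// subr_ge0.
Qed.

Lemma primitive_pinched k K r : nonincreasing_fun k -> primitive k K ->
  0 <= r -> pinched (k \o ratr) r (K \o ratr).
Proof.
move=> kni KP r0 alpha beta ra ab /=; rewrite rmorphB/=.
have a0 : 0 <= ratr alpha :> R by rewrite ler0q (le_trans r0).
have ab' : ratr alpha <= ratr beta :> R by rewrite ler_rat ltW.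
by rewrite (proj1 (KP.2 _ _ a0 ab')) primitive_le.
Qed.

End primitive.

(** * Darboux integrals of nonincreasing functions *)

Section riemann.
Variable R : realType.
Implicit Types (k K : R -> R) (a b s t : R) (h : R -> \bar R).
Local Open Scope ereal_scope.

Lemma lower_sum_cons h a b x (s : seq R) : lower_sum h a b (x :: s) =
  (x - a)%:E * ereal_inf (h @` `[a, x]%classic) + lower_sum h x b s.
Proof.
by rewrite /lower_sum/= big_nat_recl.
Qed.

Lemma upper_sum_cons h a b x (s : seq R) : upper_sum h a b (x :: s) =
  (x - a)%:E * ereal_sup (h @` `[a, x]%classic) + upper_sum h x b s.
Proof.
by rewrite /upper_sum/= big_nat_recl.
Qed.

Lemma ereal_inf_nonincreasing k a b : nonincreasing_fun k -> (a <= b)%R ->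
  ereal_inf ((EFin \o k) @` `[a, b]%classic) = (k b)%:E.
Proof.
move=> kni ab; apply/eqP; rewrite eq_le; apply/andP; split.
  by apply: ereal_inf_lbound; exists b => //=; rewrite in_itv/= ab lexx.
apply: le_ereal_inf_tmp => _ [x /= + <-]; rewrite in_itv/= => /andP[_ xb].
by rewrite lee_fin kni.
Qed.

Lemma ereal_sup_nonincreasing k a b : nonincreasing_fun k -> (a <= b)%R ->
  ereal_sup ((EFin \o k) @` `[a, b]%classic) = (k a)%:E.
Proof.
move=> kni ab; apply/eqP; rewrite eq_le; apply/andP; split; last first.
  by apply: ereal_sup_ubound; exists a => //=; rewrite in_itv/= ab lexx.
apply: ge_ereal_sup => _ [x /= + <-]; rewrite in_itv/= => /andP[ax _].
by rewrite lee_fin kni.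
Qed.

Lemma darboux_sums k K a b (s : seq R) : nonincreasing_fun k -> primitive k K ->
  (0 <= a)%R -> itv_partition a b s ->
  lower_sum (EFin \o k) a b s <= (K b - K a)%:E <= upper_sum (EFin \o k) a b s.
Proof.
move=> kni KP; elim: s a => [|x s IHs] a a0 abs.
  rewrite (itv_partition_nil abs) subrr /lower_sum /upper_sum/=.
  by rewrite !big_geq// lexx.
have ax : (a <= x)%R by have [/= /andP[/ltW]] := abs.
have := IHs _ (le_trans a0 ax) (itv_partition_cons abs).
rewrite lower_sum_cons upper_sum_cons ereal_inf_nonincreasing//.
rewrite ereal_sup_nonincreasing// -!EFinM.
have -> : (K b - K a)%:E = (K x - K a)%:E + (K b - K x)%:E.
  by rewrite -EFinD; congr EFin; ring.
move=> /andP[ls us]; apply/andP; split; apply: leeD => //; rewrite lee_fin.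
- by have [] := KP.2 _ _ a0 ax.
- exact: primitive_le KP _ _.
Qed.

(** On n steps of equal length e, lower and upper sums differ by the telescoping
    sum e * (k a - k b), so both are within that distance of K b - K a. *)
Lemma darboux_equipartition k K a b (e : R) n : nonincreasing_fun k ->
  primitive k K -> (0 <= a)%R -> (0 < e)%R ->
  b = (a + e * n%:R)%R -> exists2 s, itv_partition a b s &
    (K b - K a - e * (k a - k b))%:E <= lower_sum (EFin \o k) a b s /\
    upper_sum (EFin \o k) a b s <= (K b - K a + e * (k a - k b))%:E.
Proof.
move=> kni KP; elim: n a => [|n IHn] a a0 e0.
  rewrite mulr0 addr0 => ->; exists [::]; first by split => /=.
  by rewrite /lower_sum /upper_sum !big_geq// !subrr mulr0 subrr addr0.
have ae : (a < a + e)%R by rewrite ltrDl.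
have -> : (a + e * n.+1%:R = a + e + e * n%:R)%R by rewrite -natr1; ring.
move=> /(IHn _ (le_trans a0 (ltW ae)) e0)[s ps [ls us]].
exists ((a + e)%R :: s).
  by have [p1 p2] := ps; split => //=; rewrite ae.
rewrite lower_sum_cons upper_sum_cons (ereal_inf_nonincreasing _ (ltW ae))//.
rewrite (ereal_sup_nonincreasing _ (ltW ae))// -!EFinM.
have := KP.2 _ _ a0 (ltW ae) => -[h1 _].
have h2 := primitive_le kni KP a0 (ltW ae).
have ea : (a + e - a = e)%R by ring.
rewrite ea in h1 h2 *.
split.
- apply: le_trans (leeD (lexx _) ls).
  rewrite -EFinD lee_fin; lra.
- apply: le_trans (leeD (lexx _) us) _.
  rewrite -EFinD lee_fin; lra.
Qed.

Lemma riemann_integral_nonincreasing k K a b : nonincreasing_fun k ->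
  primitive k K -> (0 <= a)%R -> (a < b)%R ->
  is_riemann_integral (EFin \o k) a b (K b - K a)%:E.
Proof.
move=> kni KP a0 ab.
have approx (d : R) : (0 < d)%R -> exists2 s, itv_partition a b s &
    (K b - K a - d)%:E <= lower_sum (EFin \o k) a b s /\
    upper_sum (EFin \o k) a b s <= (K b - K a + d)%:E.
  move=> d0; pose c := ((b - a) * (k a - k b))%R.
  pose n := (Num.truncn (c / d)).+1.
  have cn : (c / n%:R < d)%R.
    by rewrite ltr_pdivrMr// mulrC -ltr_pdivrMr// truncnS_gt.
  have e0 : (0 < (b - a) / n%:R)%R by rewrite divr_gt0 ?ltr0n// subr_gt0.
  have bE : (b = a + (b - a) / n%:R * n%:R)%R.
    by rewrite divfK ?pnatr_eq0//; ring.
  have := darboux_equipartition kni KP a0 e0 bE.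
  have -> : ((b - a) / n%:R * (k a - k b) = c / n%:R)%R by rewrite /c mulrAC.
  move=> -[s ps [ls us]]; exists s => //; split.
  - by apply: le_trans ls; rewrite lee_fin; lra.
  - by apply: le_trans us _; rewrite lee_fin; lra.
split; apply/eqP; rewrite eq_le; apply/andP; split.
- by apply: ge_ereal_sup => _ [s /(darboux_sums kni KP a0)/andP[? _] <-].
- apply/lee_addgt0Pr => d d0; have [s ps [ls _]] := approx _ d0.
  rewrite -leeBlDr// -EFinB; apply: (le_trans ls).
  by apply: ereal_sup_ubound; exists s.
- apply/lee_addgt0Pr => d d0; have [s ps [_ us]] := approx _ d0.
  rewrite -EFinD; apply: le_trans us.
  by apply: ereal_inf_lbound; exists s.
- by apply: le_ereal_inf_tmp => _ [s /(darboux_sums kni KP a0)/andP[_ ?] <-].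
Qed.

(** The lower endpoint contributes nothing to the limit because
    0 <= K s <= s * k 0. *)
Lemma improper_integral_nonincreasing k K (v : R) : nonincreasing_fun k ->
  (forall x, (0 <= k x)%R) -> primitive k K ->
  is_improper_riemann_integral (EFin \o k) v%:E <-> K t @[t --> +oo%R] --> v.
Proof.
move=> kni k0 KP.
have K0 : K s @[s --> 0%R^'+] --> 0%R.
  apply: (@squeeze_cvgr _ _ _ _ (cst 0%R) (fun s => s * k 0)%R).
  - near=> s; have s0 : (0 < s)%R by near: s; exact: nbhs_right_gt.
    have := KP.2 0%R s (lexx _) (ltW s0) => -[].
    have := primitive_le kni KP (lexx _) (ltW s0); rewrite KP.1 !subr0 /= => -> + _.
    by move=> h; rewrite (le_trans _ h)// mulr_ge0// ltW.
  - exact: cvg_cst.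
  - rewrite -[X in _ --> X](mul0r (k 0%R)); apply: cvgMl.
    exact: cvg_at_right_filter.
have riem : \forall p \near (0%R^'+, +oo%R),
    is_riemann_integral (EFin \o k) p.1 p.2 (K p.2 - K p.1)%:E.
  exists ([set s : R | 0 < s < 1]%R, [set t : R | 1 < t]%R) => /=.
    split; last by exists 1%R.
    near=> s; apply/andP; split; near: s; first exact: nbhs_right_gt.
    exact: nbhs_right_lt.
  move=> [s t] /= [/andP[s0 s1] t1]; apply: riemann_integral_nonincreasing => //.
    exact: ltW.
  exact: lt_trans t1.
have FF : Filter (filter_prod (0%R : R)^'+ (+oo%R : set_system R)).
  exact: filter_prod_filter.
have K1 : K p.1 @[p --> ((0%R : R)^'+, +oo%R : set_system R)] --> 0%R.
  exact: (cvg_comp fst K cvg_fst K0).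
split => [[F HF Fv]|Kv].
- have : (K p.2 - K p.1)%:E @[p --> (0%R^'+, +oo%R)] --> v%:E.
    apply: cvg_trans Fv; apply: near_eq_cvg.
    by apply: filterS2 HF riem => p [<- _] [<- _].
  move=> /fine_cvgP[_] /= h.
  have : K p.2 @[p --> ((0%R : R)^'+, +oo%R : set_system R)] --> v.
    have -> : (fun p : R * R => K p.2) = (fun p => (K p.2 - K p.1) + K p.1)%R.
      by apply/funext => p; rewrite subrK.
    rewrite -[X in _ --> X]addr0; apply: cvgD; [exact: h|exact: K1].
  (* The function depends on the second coordinate only: fix any admissible
     value of the first one. *)
  move=> {}h N /h [[P Q] /= [P0 Qy] PQ].
  have [s Ps] := @filter_ex _ _ (at_right_proper_filter (0%R : R)) _ P0.
  by apply: filterS Qy => t Qt; apply: (PQ (s, t)).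
- exists (fun p => (K p.2 - K p.1)%:E) => //.
  apply: cvg_EFin; first by near=> p.
  rewrite -[v]subr0; apply: cvgB; last exact: K1.
  have FR := at_right_proper_filter (0%R : R).
  by apply: (cvg_comp snd K _ Kv); exact: cvg_snd.
Unshelve. all: by end_near. Qed.

End riemann.

(** * The Choquet integral through superlevel sets *)

Section choquet.
Context d (U : measurableType d) (R : realType).
Implicit Types (mu nu : set U -> \bar R) (A B : set U) (f : U -> \bar R).

Definition superlevel f (t : R) : set U := [set x | (t%:E <= f x)%E].

Definition survival nu f A (t : R) : R := fine (nu (superlevel f t `&` A)).

Lemma cvg_ratry : (ratr q : R) @[q --> pinfty_nbhs rat] --> pinfty_nbhs R.
Proof.
move=> N [M [_ MN]]; exists (Num.truncn M).+1%:R; split; first exact: num_real.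
move=> q Mq /=; apply: MN; apply: lt_trans (truncnS_gt _) _.
by rewrite -(ratr_nat R) ltr_rat.
Qed.

Lemma finite_monotone_fin_num mu A : finite_monotone_measure mu ->
  measurable A -> mu A \is a fin_num.
Proof.
move=> [[_ mu_ge0 mu_le] mu_fin] mA; rewrite ge0_fin_numE; last exact: mu_ge0.
by apply: le_lt_trans mu_fin; exact: mu_le.
Qed.

Lemma finite_monotone_le mu A B : finite_monotone_measure mu ->
  measurable A -> measurable B -> A `<=` B -> fine (mu A) <= fine (mu B).
Proof.
move=> fmu mA mB AB; rewrite fine_le ?finite_monotone_fin_num//.
by have [[_ _ mu_le] _] := fmu; exact: mu_le.
Qed.

Lemma finite_monotone_ge0 mu A : finite_monotone_measure mu ->
  measurable A -> 0 <= fine (mu A).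
Proof. by move=> [[_ mu_ge0 _] _] mA; rewrite fine_ge0// mu_ge0. Qed.

Lemma measurable_superlevel f t : measurable_fun [set: U] f ->
  measurable (superlevel f t).
Proof.
by move=> mf; rewrite -[superlevel f t]setTI; exact: emeasurable_fun_c_infty.
Qed.

Lemma superlevel_le f s t : s <= t -> superlevel f t `<=` superlevel f s.
Proof. by move=> st x /=; apply: le_trans; rewrite lee_fin. Qed.
Arguments superlevel_le [f s t] _.

Lemma nonincreasing_survival nu f A : finite_monotone_measure nu ->
  measurable_fun [set: U] f -> measurable A -> nonincreasing_fun (survival nu f A).
Proof.
move=> fnu mf mA s t st; apply: finite_monotone_le => //.
- by apply: measurableI => //; exact: measurable_superlevel.
- by apply: measurableI => //; exact: measurable_superlevel.
- by apply: setSI; exact: superlevel_le.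
Qed.

Lemma survival_ge0 nu f A t : finite_monotone_measure nu ->
  measurable_fun [set: U] f -> measurable A -> 0 <= survival nu f A t.
Proof.
move=> fnu mf mA; apply: finite_monotone_ge0 => //.
by apply: measurableI => //; exact: measurable_superlevel.
Qed.

Lemma choquet_integralP nu f A K (v : R) : finite_monotone_measure nu ->
  measurable_fun [set: U] f -> measurable A -> primitive (survival nu f A) K ->
  is_choquet_integral nu A f v%:E <-> K t @[t --> +oo] --> v.
Proof.
move=> fnu mf mA KP; rewrite /is_choquet_integral.
have -> : (fun t : R => nu ([set x | (t%:E <= f x)%E] `&` A)) =
    EFin \o survival nu f A.
  apply/funext => t /=; rewrite /survival fineK//.
  apply: finite_monotone_fin_num => //.
  by apply: measurableI => //; exact: measurable_superlevel.
apply: improper_integral_nonincreasing => // [|t].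
  exact: nonincreasing_survival.
exact: survival_ge0.
Qed.

Lemma survival_primitive nu f A : finite_monotone_measure nu ->
  measurable_fun [set: U] f -> measurable A ->
  exists K, primitive (survival nu f A) K.
Proof.
by move=> fnu mf mA; apply: primitive_exists; exact: nonincreasing_survival.
Qed.

(** Write k for the survival function of A.  That of B = A `&` {f >= q} is
    constant with value k q on [0, q] and equals k beyond q.  Its primitive L
    hence satisfies L q = q * k q and has the increments of K beyond q, so the
    limits mu B - L q and mu A - K q coincide. *)
Lemma choquet_superlevel mu nu f A K (q : rat) :
  finite_monotone_measure mu -> finite_monotone_measure nu ->
  measurable_fun [set: U] f ->
  (forall B, measurable B -> is_choquet_integral nu B f (mu B)) ->
  measurable A -> primitive (survival nu f A) K -> 0 <= q ->
  fine (mu (A `&` superlevel f (ratr q))) =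
    fine (mu A) - K (ratr q) + ratr q * survival nu f A (ratr q).
Proof.
move=> fmu fnu mf muE mA KP q0.
set B := A `&` superlevel f (ratr q).
have mB : measurable B by apply: measurableI => //; exact: measurable_superlevel.
have [L LP] := survival_primitive fnu mf mB.
have limA : K t @[t --> +oo] --> fine (mu A).
  apply/(choquet_integralP _ fnu mf mA KP).
  by rewrite fineK ?finite_monotone_fin_num//; exact: muE.
have limB : L t @[t --> +oo] --> fine (mu B).
  apply/(choquet_integralP _ fnu mf mB LP).
  by rewrite fineK ?finite_monotone_fin_num//; exact: muE.
have above t : ratr q <= t -> survival nu f B t = survival nu f A t.
  move=> qt; rewrite /survival; congr (fine (nu _)).
  by rewrite /B setICA (setIidl (superlevel_le qt)) setIC.
have below t : t <= ratr q -> survival nu f B t = survival nu f A (ratr q).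
  move=> tq; rewrite /survival /B; congr (fine (nu _)).
  by rewrite setICA (setIidr (superlevel_le tq)) setIC.
have niA := nonincreasing_survival fnu mf mA.
have niB := nonincreasing_survival fnu mf mB.
have qR : 0 <= ratr q :> R by rewrite ler0q.
have LE : L (ratr q) = ratr q * survival nu f A (ratr q).
  have [] := LP.2 _ _ (lexx _) qR; rewrite LP.1 !subr0 below// => h1 h2.
  apply/eqP; rewrite eq_le h1 andbT; apply: h2 => x _ xq; by rewrite below.
have pA := primitive_pinched niA KP q0.
have pB : pinched (survival nu f A \o ratr) q (L \o ratr).
  move=> alpha beta qa ab; have := primitive_pinched niB LP q0 qa ab => /=.
  rewrite !above// ler_rat//.
  by rewrite (le_trans qa)// ltW.
have cA : K (ratr r) - K (ratr q) @[r --> pinfty_nbhs rat] -->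
    fine (mu A) - K (ratr q).
  apply: cvgB; last exact: cvg_cst.
  exact: (cvg_comp _ _ cvg_ratry limA).
have cB : L (ratr r) - L (ratr q) @[r --> pinfty_nbhs rat] -->
    fine (mu B) - L (ratr q).
  apply: cvgB; last exact: cvg_cst.
  exact: (cvg_comp _ _ cvg_ratry limB).
suff -> : fine (mu A) - K (ratr q) = fine (mu B) - L (ratr q).
  by rewrite LE subrK.
apply: (norm_cvg_unique cA); apply: cvg_trans cB; apply: near_eq_cvg.
near=> r.
have qr : q <= r by near: r; apply: nbhs_pinfty_ge; exact: num_real.
exact: (pinched_unique pB pA qr).
Unshelve. all: by end_near. Qed.

(** * From an integral representation to a decomposition *)

Lemma decomposition_of_choquet mu nu f :
  finite_monotone_measure mu -> finite_monotone_measure nu ->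
  (forall t, 0 <= f t)%E -> measurable_fun [set: U] f ->
  (forall A, measurable A -> is_choquet_integral nu A f (mu A)) ->
  decomposition_property mu nu (fun q : rat => superlevel f (ratr q)).
Proof.
move=> fmu fnu f0 mf muE; split.
- by move=> q _; exact: measurable_superlevel.
- by move=> a b _ ab; apply: superlevel_le; rewrite ler_rat ltW.
- by rewrite rmorph0; apply/seteqP; split=> // x _; exact: f0.
- move=> A mA _ _ a b a0 ab.
  have b0 : 0 <= b by rewrite (le_trans a0)// ltW.
  have [K KP] := survival_primitive fnu mf mA.
  have mI q : measurable (A `&` superlevel f (ratr q)).
    by apply: measurableI => //; exact: measurable_superlevel.
  have finmu q := finite_monotone_fin_num fmu (mI q).
  have finnu q := finite_monotone_fin_num fnu (mI q).
  rewrite -(fineK (finmu a)) -(fineK (finmu b)).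
  rewrite -(fineK (finnu a)) -(fineK (finnu b)) -!EFinB -!EFinM !lee_fin.
  rewrite !(choquet_superlevel fmu fnu mf muE mA KP)//.
  rewrite ![A `&` _]setIC -!/(survival _ _ _ _).
  have := primitive_pinched (nonincreasing_survival fnu mf mA) KP a0 (lexx a) ab.
  by rewrite /= rmorphB/= => /andP[h1 h2]; split; lra.
Qed.

(** By [choquet_superlevel], mu {f >= q} is the tail mu U - K q plus q * k q;
    monotonicity of k on [q / 2, q] gives q * k q <= 2 * (K q - K (q / 2)), and
    nu {f >= q} = k q <= q * k q once q >= 1.  The majorant used is a bound for
    both terms, and it tends to 0 with the tails of K. *)
Lemma cvg_superlevel_of_choquet mu nu f :
  finite_monotone_measure mu -> finite_monotone_measure nu ->
  measurable_fun [set: U] f ->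
  (forall A, measurable A -> is_choquet_integral nu A f (mu A)) ->
  (maxe (mu (superlevel f (ratr q))) (nu (superlevel f (ratr q)))
    @[q --> pinfty_nbhs rat] --> 0)%E.
Proof.
move=> fmu fnu mf muE.
have [K KP] := survival_primitive fnu mf measurableT.
set k := survival nu f setT in KP.
have kni : nonincreasing_fun k by exact: nonincreasing_survival.
have cK : K t @[t --> +oo] --> fine (mu setT).
  apply/(choquet_integralP _ fnu mf measurableT KP).
  by rewrite fineK ?finite_monotone_fin_num//; exact: muE.
have mS q := measurable_superlevel q mf.
have maxE q : maxe (mu (superlevel f q)) (nu (superlevel f q)) =
    (Num.max (fine (mu (superlevel f q))) (fine (nu (superlevel f q))))%:E.
  by rewrite EFin_max !fineK ?finite_monotone_fin_num.
under eq_cvg do rewrite maxE.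
apply: cvg_EFin; first by near=> q.
apply: (@squeeze_cvgr _ _ _ _ (cst 0) (fun q : rat =>
  (fine (mu setT) - K (ratr q)) + 4 * (K (ratr q) - K (ratr q / 2)))).
- near=> q; rewrite /= le_max finite_monotone_ge0//=.
  have q1 : 1 <= q by near: q; apply: nbhs_pinfty_ge; exact: num_real.
  have q0 : 0 <= q by rewrite (le_trans _ q1).
  have q1R : 1 <= ratr q :> R by rewrite -(rmorph1 (@ratr R)) ler_rat.
  have := choquet_superlevel fmu fnu mf muE measurableT KP q0.
  rewrite setTI => ->; rewrite -/k.
  have -> : fine (nu (superlevel f (ratr q))) = k (ratr q).
    by rewrite /k /survival setIT.
  have k0 : 0 <= k (ratr q) by exact: survival_ge0.
  have hq : 0 <= ratr q / 2 :> R by rewrite divr_ge0// (le_trans _ q1R).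
  have hq2 : ratr q / 2 <= ratr q :> R by lra.
  have [tail _] := KP.2 _ _ hq hq2.
  have kq : k (ratr q) <= ratr q * k (ratr q) by rewrite ler_peMl.
  have M0 : 0 <= fine (mu setT) - K (ratr q) .
    rewrite subr_ge0; apply: (cvgr_to_ge cK).
    near=> t; apply: primitive_nondecreasing KP _ _.
    + by move=> x; exact: survival_ge0.
    + by rewrite (le_trans _ q1R).
    + by near: t; apply: nbhs_pinfty_ge; exact: num_real.
  rewrite ge_max; apply/andP; split; lra.
- exact: cvg_cst.
- have cKq : K (ratr q) @[q --> pinfty_nbhs rat] --> fine (mu setT).
    exact: (cvg_comp _ _ cvg_ratry cK).
  have cKq2 : K (ratr q / 2) @[q --> pinfty_nbhs rat] --> fine (mu setT).
    apply: (cvg_comp (fun q : rat => ratr q / 2 : R) K _ cK).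
    apply: (cvg_comp _ (fun x : R => x / 2) cvg_ratry).
    by move=> N /near_pinfty_div2.
  have -> : 0 = (fine (mu setT) - fine (mu setT))
      + 4 * (fine (mu setT) - fine (mu setT)) :> R by ring.
  apply: cvgD; first by apply: cvgB => //; exact: cvg_cst.
  by apply: cvgMr; exact: cvgB.
Unshelve. all: by end_near. Qed.

(** * From a decomposition to an integral representation *)

Definition family_sup (F : rat -> set U) (x : U) : \bar R :=
  ereal_sup [set (ratr q)%:E | q in [set q | 0 <= q /\ F q x]].

Section converse.
Variables (mu nu : set U -> \bar R) (F : rat -> set U).
Hypothesis fmu : finite_monotone_measure mu.
Hypothesis fnu : finite_monotone_measure nu.
Hypothesis decF : decomposition_property mu nu F.

Lemma family_sup_ge0 x : (0 <= family_sup F x)%E.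
Proof.
apply: ereal_sup_ubound; exists 0; last by rewrite rmorph0.
by split => //; have [_ _ -> _] := decF.
Qed.

Lemma subset_superlevel_family_sup (q : rat) (t : R) : 0 <= q -> t <= ratr q ->
  F q `<=` superlevel (family_sup F) t.
Proof.
move=> q0 tq x Fqx; apply: (@le_trans _ _ (ratr q)%:E); first by rewrite lee_fin.
by apply: ereal_sup_ubound; exists q.
Qed.

Lemma superlevel_family_sup_subset (q : rat) (t : R) : 0 <= q -> ratr q < t ->
  superlevel (family_sup F) t `<=` F q.
Proof.
move=> q0 qt x /= tx.
have /ereal_sup_gt[_ [r [r0 Frx] <-]] : ((ratr q)%:E < family_sup F x)%E.
  by apply: lt_le_trans tx; rewrite lte_fin.
rewrite lte_fin ltr_rat => qr; have [_ decr _ _] := decF.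
exact: (decr _ _ q0 qr).
Qed.

Lemma measurable_family_sup : measurable_fun [set: U] (family_sup F).
Proof.
apply: (measurability _ (ErealGenOInfty.measurableE R)) => // _ [_ [y ->] <-].
rewrite setTI.
have -> : family_sup F @^-1` `]y%:E, +oo[%classic =
    \bigcup_(q in [set q : rat | 0 <= q /\ y < ratr q]) F q.
  apply/seteqP; split => [x|x [q [q0 yq] Fqx]].
    rewrite /= in_itv/= andbT => /ereal_sup_gt[_ [q [q0 Fqx] <-]].
    by rewrite lte_fin => yq; exists q.
  rewrite /= in_itv/= andbT; apply: (@lt_le_trans _ _ (ratr q)%:E).
    by rewrite lte_fin.
  by apply: ereal_sup_ubound; exists q.
rewrite bigcup_mkcond; apply: bigcupT_measurable_rat => q.
case: ifPn => [|_]; last exact: measurable0.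
by rewrite inE/= => -[q0 _]; have [mF _ _ _] := decF; exact: mF.
Qed.

Hypothesis limF :
  (maxe (mu (F q)) (nu (F q)) @[q --> pinfty_nbhs rat] --> 0)%E.

Lemma family_eventually_small (e : R) : 0 < e ->
  \forall q \near pinfty_nbhs rat, fine (mu (F q)) < e /\ fine (nu (F q)) < e.
Proof.
move=> e0; have [mF _ _ _] := decF.
have /fine_cvgP[_ /cvgrPdist_lt /(_ e e0)] := limF.
apply: filterS2 (nbhs_pinfty_ge (num_real 0)) => q q0 /=.
rewrite -(fineK (finite_monotone_fin_num fmu (mF q q0))).
rewrite -(fineK (finite_monotone_fin_num fnu (mF q q0))) -EFin_max/=.
by rewrite sub0r normrN => /(le_lt_trans (ler_norm _)); rewrite gt_max => /andP.
Qed.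

(** Both K and q g(q) - m(q) have rational increments squeezed by g, so they
    agree up to a constant; letting q grow then gives the integral. *)
Lemma choquet_of_decomposition A : measurable A ->
  is_choquet_integral nu A (family_sup F) (mu A).
Proof.
move=> mA; have [mF decr F0 ineq] := decF.
have mf := measurable_family_sup.
have [K KP] := survival_primitive fnu mf mA.
set k := survival nu (family_sup F) A in KP.
rewrite -(fineK (finite_monotone_fin_num fmu mA)).
apply/(choquet_integralP _ fnu mf mA KP).
pose m q := fine (mu (A `&` F q)); pose g q := fine (nu (A `&` F q)).
have mI q : 0 <= q -> measurable (A `&` F q).
  by move=> q0; apply: measurableI => //; exact: mF.
have m_ge0 q : 0 <= q -> 0 <= m q by move=> /mI; exact: finite_monotone_ge0.
have g_ge0 q : 0 <= q -> 0 <= g q by move=> /mI; exact: finite_monotone_ge0.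
have mle q : 0 <= q -> m q <= fine (mu (F q)).
  by move=> q0; apply: finite_monotone_le => //; [exact: mI|exact: mF].
have gle q : 0 <= q -> g q <= fine (nu (F q)).
  by move=> q0; apply: finite_monotone_le => //; [exact: mI|exact: mF].
have mg a b : 0 <= a -> a < b ->
    ratr a * (g a - g b) <= m a - m b /\ m a - m b <= ratr b * (g a - g b).
  move=> a0 ab; have b0 : 0 <= b by rewrite (le_trans a0)// ltW.
  have fin0 (rho : set U -> \bar R) : finite_monotone_measure rho -> (rho A < +oo)%E.
    by move=> frho; have /fin_numPlt/andP[] := finite_monotone_fin_num frho mA.
  have := ineq A mA (fin0 _ fmu) (fin0 _ fnu) a b a0 ab.
  rewrite -(fineK (finite_monotone_fin_num fmu (mI a a0))).
  rewrite -(fineK (finite_monotone_fin_num fmu (mI b b0))).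
  rewrite -(fineK (finite_monotone_fin_num fnu (mI a a0))).
  rewrite -(fineK (finite_monotone_fin_num fnu (mI b b0))).
  by rewrite -!EFinB -!EFinM !lee_fin.
have pJ : pinched g 0 (fun q => ratr q * g q - m q).
  move=> a b a0 ab; have [h1 h2] := mg _ _ a0 ab; rewrite rmorphB/=.
  by apply/andP; split; lra.
have pK : pinched g 0 (K \o ratr).
  move=> a b a0 ab; have b0 : 0 <= b by rewrite (le_trans a0)// ltW.
  have abR : ratr a < ratr b :> R by rewrite ltr_rat.
  have aR : 0 <= ratr a :> R by rewrite ler0q.
  have [h1 h2] := KP.2 _ _ aR (ltW abR).
  rewrite /= rmorphB/=; apply/andP; split.
  - apply: le_trans h1; rewrite ler_wpM2l ?subr_ge0 ?(ltW abR)//.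
    rewrite /k /survival setIC; apply: finite_monotone_le => //.
    + exact: mI.
    + by apply: measurableI => //; exact: measurable_superlevel.
    + by apply: setIS; exact: subset_superlevel_family_sup.
  - apply: h2 => x ax _.
    rewrite /k /survival setIC; apply: finite_monotone_le => //.
    + by apply: measurableI => //; exact: measurable_superlevel.
    + exact: mI.
    + by apply: setIS; exact: superlevel_family_sup_subset.
have KE q : 0 <= q -> K (ratr q) = fine (mu A) - (m q - ratr q * g q).
  move=> q0; have := pinched_unique pK pJ q0.
  by rewrite /= rmorph0 KP.1 mul0r /m F0 setIT; lra.
(* The decomposition inequality between q and b, in the limit of large b. *)
have Jge0 q : 0 <= q -> ratr q * g q <= m q.
  move=> q0; apply/ler_addgt0Pr => e e0.
  have qR : 0 <= ratr q :> R by rewrite ler0q.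
  have e1 : 0 < e / (ratr q + 1) by rewrite divr_gt0// ltr_wpDl.
  near (pinfty_nbhs rat) => b.
  have qb : q < b by near: b; apply: nbhs_pinfty_gt; exact: num_real.
  have b0 : 0 <= b by rewrite (le_trans q0)// ltW.
  have [_ nub] : fine (mu (F b)) < e / (ratr q + 1)
      /\ fine (nu (F b)) < e / (ratr q + 1).
    by near: b; exact: family_eventually_small.
  have [h1 _] := mg _ _ q0 qb.
  have : ratr q * g b <= ratr q * (e / (ratr q + 1)).
    by rewrite ler_wpM2l// (le_trans (gle _ b0))// ltW.
  have : ratr q * (e / (ratr q + 1)) <= e.
    by rewrite mulrCA ger_pMr// ler_pdivrMr ?ltr_wpDl// mul1r lerDl.
  have := m_ge0 _ b0; lra.
have k0 x : 0 <= k x by exact: survival_ge0.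
apply/cvgrPdist_lt => e e0.
near (pinfty_nbhs rat) => q.
have q0 : 0 <= q by near: q; apply: nbhs_pinfty_ge; exact: num_real.
have [muq _] : fine (mu (F q)) < e /\ fine (nu (F q)) < e.
  by near: q; exact: family_eventually_small.
near=> t.
have qt : ratr q <= t by near: t; apply: nbhs_pinfty_ge; exact: num_real.
have qR : 0 <= ratr q :> R by rewrite ler0q.
(* K is known at rational points only; since it is nondecreasing, its value at
   t is enclosed by those at q and at an integer above t. *)
have tn : t <= ratr (Num.truncn t).+1%:R by rewrite ratr_nat ltW// truncnS_gt.
have := primitive_nondecreasing k0 KP qR qt.
have := primitive_nondecreasing k0 KP (le_trans qR qt) tn.
rewrite !KE//.
have := Jge0 (Num.truncn t).+1%:R (ler0n _ _).
have := mulr_ge0 qR (g_ge0 _ q0); have := mle _ q0.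
by move=> *; rewrite ltr_norml; apply/andP; split; lra.
Unshelve. all: by end_near. Qed.

End converse.
End choquet.

Local Open Scope ereal_scope.

Theorem theorem3p4 (d : measure_display) (U : measurableType d) (R : realType)
    (U_nonempty : [set: U] !=set0) (mu nu : set U -> \bar R)
    (mu_fin : finite_monotone_measure mu)
    (nu_fin : finite_monotone_measure nu) :
  (exists f : U -> \bar R,
     [/\ forall t, 0 <= f t,
         measurable_fun [set: U] f &
         forall A, measurable A -> is_choquet_integral nu A f (mu A)])
  <->
  (exists F : rat -> set U,
     decomposition_property mu nu F /\
     maxe (mu (F alpha)) (nu (F alpha)) @[alpha --> pinfty_nbhs rat] --> 0).
Proof.
split => [[f [f0 mf muE]]|[F [decF limF]]].
- exists (fun q => superlevel f (ratr q)); split.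
    exact: decomposition_of_choquet.
  exact: cvg_superlevel_of_choquet.
- exists (family_sup R F); split.
  + exact: family_sup_ge0 decF.
  + exact: measurable_family_sup decF.
  + exact: choquet_of_decomposition.
Qed.
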